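(* Let $(p_n)_{n\ge 1}$ be a sequence in $[0,1]$ with $p_n = \frac1n + O(n^{-4/3})$ as $n\to\infty$, and write $p=p_n$. Then, as $n\to\infty$, $\operatorname{diam}(\vec G(n,p)) = O_{\mathbb P}(n^{1/3})$.
   Context: For $n\ge 1$ and $p\in[0,1]$, $\vec G(n,p)$ is the random directed graph on the vertex set $\{1,2,\dots,n\}$ in which each of the $n(n-1)$ possible directed edges $(u,v)$, $u\ne v$, is independently present with probability $p$. A saop (self-avoiding oriented path) of length $k$ in a directed graph $\vec G$ is a sequence of vertices $(v_0,v_1,\dots,v_k)$ such that the oriented edges $(v_0,v_1),\dots,(v_{k-1},v_k)$ are pairwise different and all belong to $\vec G$ (a single vertex is a saop of length $0$). For vertices $i,j$ of $\vec G$, $d_\rightarrow(i,j)$ is the minimal length of a saop from $i$ to $j$, with $d_\rightarrow(i,j)=-\infty$ if there is no such path. The diameter is $\operatorname{diam}(\vec G):=\max_{i,j\in\vec G} d_\rightarrow(i,j)$. For a sequence $(X_n)$ of real random variables and a positive function $f$ on the positive integers, $X_n=O_{\mathbb P}(f(n))$ means that the sequence $(X_n/f(n))_n$ is tight. *)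

(* Defs.v *)
From HB Require Import structures.
From mathcomp Require Import all_boot all_order all_algebra.
From mathcomp Require Import all_classical all_reals all_analysis.
From mathcomp Require Import measurable_realfun.

Set Implicit Arguments.
Unset Strict Implicit.
Unset Printing Implicit Defensive.

Import Order.TTheory GRing.Theory Num.Theory.
Import numFieldNormedType.Exports.

Local Open Scope classical_set_scope.
Local Open Scope ring_scope.

Definition edge (n : nat) := {e : 'I_n * 'I_n | e.1 != e.2}.

(* The vertices 1, ..., n are represented by 'I_n, and a directed graph by its
   set of edges. *)
Definition digraph (n : nat) := {set edge n}.

Definition empty_digraph (n : nat) : digraph n := finset.set0.

HB.instance Definition _ n := Finite.on (digraph n).
HB.instance Definition _ n := isPointed.Build (digraph n) (empty_digraph n).
HB.instance Definition _ n := @isMeasurable.Build default_measure_display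
  (digraph n) discrete_measurable discrete_measurable0
  discrete_measurableC discrete_measurableU.

Section gnp.
Context {R : realType} (n : nat) (p : R).

Definition gnp_pmf (G : digraph n) : R :=
  \prod_(e : edge n) bernoulli_pmf p (e \in (G : {set edge n})).

(* The law of G(n, p). As for [bernoulli_prob], the value for p outside [0, 1]
   is a dummy Dirac mass. *)
Definition gnp_prob (A : set (digraph n)) : \bar R :=
  if 0 <= p <= 1 then \sum_(G \in A) (gnp_pmf G)%:E
  else \d_(empty_digraph n) A.

Lemma gnp_pmf_ge0 G : 0 <= p <= 1 -> 0 <= gnp_pmf G.
Proof. by move=> p01; apply: prodr_ge0 => e _; exact: bernoulli_pmf_ge0. Qed.

Lemma gnp_pmf1 : \sum_(G : digraph n) gnp_pmf G = 1.
Proof.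
rewrite /gnp_pmf /bernoulli_pmf.
have := @bigA_distr R 0 1 *%R +%R (edge n) (fun=> p) (fun=> 1 - p).
rewrite big1 => [|i _]; last by rewrite /= subrKC.
by move=> e; rewrite [RHS]e; apply: eq_big => // G _; exact: eq_bigr.
Qed.

Let gnp0 : gnp_prob set0 = 0%E.
Proof. by rewrite /gnp_prob; case: ifPn => // p01; rewrite fsbig_set0. Qed.

Let gnp_ge0 U : (0 <= gnp_prob U)%E.
Proof.
rewrite /gnp_prob; case: ifPn => // p01.
rewrite fsbig_finite//= sumEFin lee_fin.
by apply: sumr_ge0 => /= G _; exact: gnp_pmf_ge0.
Qed.

Let gnp_sigma_additive : semi_sigma_additive gnp_prob.
Proof.
move=> F mF tF mUF; rewrite /gnp_prob; case: ifPn => p01; last first.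
  exact: measure_semi_sigma_additive.
apply: cvg_toP.
  apply: ereal_nondecreasing_is_cvgn => m k mk.
  apply: lee_sum_nneg_natr => // i _ _.
  rewrite fsbig_finite//= sumEFin lee_fin.
  by apply: sumr_ge0 => /= b _; exact: gnp_pmf_ge0.
transitivity (\sum_(0 <= i <oo) (\esum_(j in F i) (gnp_pmf j)%:E))%E.
  apply: eq_eseriesr => k _; rewrite esum_fset//= => b _.
  by rewrite lee_fin gnp_pmf_ge0.
rewrite -nneseries_sum_bigcup//=; last first.
  by move=> b; rewrite lee_fin gnp_pmf_ge0.
by rewrite esum_fset//= => b _; rewrite lee_fin gnp_pmf_ge0.
Qed.

HB.instance Definition _ := isMeasure.Build _ _ _ gnp_prob
  gnp0 gnp_ge0 gnp_sigma_additive.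

Let gnp_setT : gnp_prob [set: _] = 1%E.
Proof.
rewrite /gnp_prob /= probability_setT; case: ifPn => // _.
have -> : [set: digraph n] = [set` index_enum (digraph n)].
  by apply/esym/seteqP; split => G //= _; exact: mem_index_enum.
by rewrite -fsbig_seq ?index_enum_uniq// sumEFin gnp_pmf1.
Qed.

HB.instance Definition _ :=
  @Measure_isProbability.Build _ _ R gnp_prob gnp_setT.

End gnp.
Arguments gnp_pmf {R n} p G.
Arguments gnp_prob {R} n p A.

Section diameter.
Context {n : nat}.
Implicit Types (G : digraph n) (i j : 'I_n).

Definition arrow G : rel 'I_n :=
  fun u v => (u, v) \in [set val e | e in (G : {set edge n})]%SET.

(* [saop G v0 [:: v1; ...; vk]]: (v0, v1, ..., vk) is a saop of G, of length k;
   only its edges, not its vertices, have to be pairwise different. *)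
Definition saop G (v0 : 'I_n) (s : seq 'I_n) : bool :=
  path (arrow G) v0 s && uniq (pairmap pair v0 s).

Definition saop_of_length G i j (k : nat) : bool :=
  [exists s : k.-tuple 'I_n, saop G i s && (last i s == j)].

Definition dist {R : realType} G i j : \bar R :=
  if pselect (exists k, saop_of_length G i j k) is left ex
  then (ex_minn ex)%:R%:E else -oo%E.

Definition diam_ereal {R : realType} G : \bar R :=
  \big[maxe/-oo%E]_i \big[maxe/-oo%E]_j dist G i j.

(* No information is lost for n > 0, see [diamE] below. *)
Definition diam {R : realType} G : R := fine (diam_ereal G).

Lemma diamE {R : realType} G : (0 < n)%N -> (diam G)%:E = diam_ereal G :> \bar R.
Proof.
move=> n0; apply: fineK; rewrite fin_numElt; apply/andP; split.
- pose i := Ordinal n0.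
  suff : (0%E <= @diam_ereal R G)%E by apply: lt_le_trans; exact: ltNy0.
  apply: le_trans (le_bigmax_cond _ _ (isT : xpredT i)).
  apply: le_trans (le_bigmax_cond _ _ (isT : xpredT i)).
  rewrite /dist; case: pselect => [ex|[]]; first by rewrite lee_fin ler0n.
  by exists 0%N; apply/existsP; exists [tuple]; rewrite /= eqxx.
- apply: bigmax_lt => // i _; apply: bigmax_lt => // j _.
  by rewrite /dist; case: pselect => *; rewrite ?ltry.
Qed.

Let measurable_diam (R : realType) : measurable_fun setT (@diam R).
Proof. by []. Qed.

HB.instance Definition _ (R : realType) :=
  isMeasurableFun.Build _ _ (digraph n) R (@diam R) (@measurable_diam R).

End diameter.

(* Sequences are indexed by the positive integers: the term of index 0 is
   ignored. *)
Definition tight {R : realType} (d : nat -> measure_display)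
    (T : forall n, measurableType (d n)) (P : forall n, probability (T n) R)
    (X : forall n, {RV (P n) >-> R}) : Prop :=
  forall eps : R, 0 < eps -> exists M : R, forall n, (0 < n)%N ->
    (P n [set w | (M < `|X n w|)%R] <= eps%:E)%E.

Arguments tight {R d T} P X.

Definition stochastic_bigO {R : realType} (d : nat -> measure_display)
    (T : forall n, measurableType (d n)) (P : forall n, probability (T n) R)
    (X : forall n, {RV (P n) >-> R}) (f : nat -> R) : Prop :=
  tight P (fun n => scale_mfun (f n)^-1 (X n)).
Arguments stochastic_bigO {R d T} P X f.

(* Main.v *)
Require Import Defs.
From mathcomp Require Import all_boot all_order all_algebra.
From mathcomp Require Import all_classical all_reals all_analysis.
From mathcomp Require Import measurable_realfun.
From mathcomp Require Import ring lra.

Set Implicit Arguments.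
Unset Strict Implicit.
Unset Printing Implicit Defensive.

Import Order.TTheory GRing.Theory Num.Theory.
Import numFieldNormedType.Exports.

Local Open Scope ring_scope.

(* Let m be the integer part of n^(1/3).  An oriented path with pairwise distinct
   vertices and length at least (A + 2) m has at least A m vertices that start
   one half and end the other half of a subpath of length 2 m.  For a given
   vertex, the two halves use disjoint sets of edges, so the van den Berg-Kesten
   inequality bounds the probability that both exist by h_m^2, where h_k bounds
   the probability that a path of length k starts at a given vertex.  By Harris'
   inequality one can take h_(k+1) = 1 - (1 - p h_k)^(n+1), as for the survival
   of a branching process, and in the critical window this gives h_m = O(1 / m).
   The expected number of such vertices is thus O(n / m^2) = O(m), and Markov's
   inequality bounds the probability of a long path by O(1 / A). *)

(** * Product Bernoulli measures: the inequalities of Harris and van den Berg-Kesten *)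

Section bernoulli_product.
Import mathcomp.boot.fintype mathcomp.boot.finset.
Context {R : realFieldType} {E : finType} (p : R).
Hypothesis p01 : 0 <= p <= 1.
Implicit Types (e : E) (s : seq E) (G H : {set E}) (f g : {set E} -> R).

Let p0 : 0 <= p. Proof. by case/andP: p01. Qed.
Let q0 : 0 <= 1 - p. Proof. by rewrite subr_ge0; case/andP: p01. Qed.

(* Expectation of [f] over the random set obtained from [G] by adding each
   element of [s] independently with probability [p]. *)
Fixpoint expect s f G : R :=
  if s is e :: s' then p * expect s' f (e |: G) + (1 - p) * expect s' f G
  else f G.

Lemma expect_le s f g G :
  (forall H, f H <= g H) -> expect s f G <= expect s g G.
Proof.
by move=> fg; elim: s G => [|e s IH] G //=; rewrite lerD ?ler_wpM2l.
Qed.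

Lemma expect_cst s c G : expect s (fun=> c) G = c.
Proof. by elim: s G => [|e s IH] G //=; rewrite !IH; ring. Qed.

Lemma expect_ge0 s f G : (forall H, 0 <= f H) -> 0 <= expect s f G.
Proof. by move=> f0; rewrite -(expect_cst s 0 G) expect_le. Qed.

Lemma expectB1 s f G : expect s (fun H => 1 - f H) G = 1 - expect s f G.
Proof. by elim: s G => [|e s IH] G //=; rewrite !IH; ring. Qed.

Lemma expect_sum (I : finType) s (F : I -> {set E} -> R) G :
  expect s (fun H => \sum_i F i H) G = \sum_i expect s (F i) G.
Proof.
by elim: s G => [|e s IH] G //=; rewrite !IH !mulr_sumr -big_split.
Qed.

Definition antitone f := forall G H, G \subset H -> f H <= f G.

Lemma expect_antitone s f : antitone f -> antitone (expect s f).
Proof.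
move=> fa; elim: s => [|e s IH] //= G H GH.
by rewrite lerD// ler_wpM2l// IH// setUS.
Qed.

(** Splitting off [e] contributes a covariance: [p * (1 - p)] times the product of the drops of the
    two expectations when [e] is added, both nonnegative. *)
Lemma harris s f g G : antitone f -> antitone g ->
  expect s f G * expect s g G <= expect s (fun H => f H * g H) G.
Proof.
move=> fa ga; elim: s G => [|e s IH] G //=.
have fe := expect_antitone s fa (subsetUr [set e] G).
have ge := expect_antitone s ga (subsetUr [set e] G).
have IH1 := ler_wpM2l p0 (IH (e |: G)); have IH0 := ler_wpM2l q0 (IH G).
apply: le_trans (lerD IH1 IH0); rewrite -subr_ge0.
rewrite -subr_ge0 in fe; rewrite -subr_ge0 in ge.
have := mulr_ge0 (mulr_ge0 p0 q0) (mulr_ge0 fe ge); lra.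
Qed.

Lemma harris_prod (I : finType) (U : {set I}) s (F : I -> {set E} -> R) G :
  (forall i, antitone (F i)) -> (forall i H, 0 <= F i H) ->
  \prod_(i in U) expect s (F i) G <= expect s (fun H => \prod_(i in U) F i H) G.
Proof.
move=> Fa F0.
suff: forall r : seq I, \prod_(i <- r | i \in U) expect s (F i) G
    <= expect s (fun H => \prod_(i <- r | i \in U) F i H) G by exact.
elim=> [|i r IH].
  rewrite big_nil -[leLHS](expect_cst s 1 G).
  by apply: expect_le => H; rewrite big_nil.
have -> : expect s (fun H => \prod_(j <- i :: r | j \in U) F j H) G =
   expect s (fun H => if i \in U then F i H * \prod_(j <- r | j \in U) F j H
                      else \prod_(j <- r | j \in U) F j H) G.
  by apply: le_anti; rewrite !expect_le// => H; rewrite big_cons.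
rewrite big_cons; case: ifPn => // iU.
apply: le_trans (harris _ _ _ _) => //.
  by rewrite ler_wpM2l// expect_ge0.
move=> A B AB; elim: r {IH} => [|j r IH]; first by rewrite !big_nil.
rewrite !big_cons; case: ifPn => // jU.
by rewrite ler_pM ?Fa// prodr_ge0.
Qed.

Lemma expect_ignore s f e G :
  (forall H, f (e |: H) = f H) -> expect s f (e |: G) = expect s f G.
Proof. by move=> fe; elim: s G => [|e' s IH] G //=; rewrite setUCA !IH. Qed.

(** The presence of [e] is independent of an [f] that ignores [e]. This is only an inequality
    because [e] may be missing from [s], which makes the left side 0. *)
Lemma expect_mem s f e G : uniq s -> e \notin G -> (forall H, 0 <= f H) ->
  (forall H, f (e |: H) = f H) ->
  expect s (fun H => (e \in H)%:R * f H) G <= p * expect s f G.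
Proof.
move=> + + f0 fe; elim: s G => [|e' s IH] G /=.
  by move=> _ /negPf->; rewrite mul0r mulr_ge0.
move=> /andP[e's us] eG; have [ee|ee] := eqVneq e e'; last first.
  have IH0 := ler_wpM2l q0 (IH _ us eG).
  have : e \notin e' |: G by rewrite !inE negb_or ee.
  by move=> /(IH _ us)/(ler_wpM2l p0); lra.
rewrite -ee in e's *.
have out H : expect s (fun H => (e \in H)%:R * f H) H
    = (e \in H)%:R * expect s f H.
  elim: s {IH us} e's H => [|a s IH] //=; rewrite inE negb_or => /andP[ea es] H.
  by rewrite !IH// !inE (negPf ea)/=; ring.
rewrite !out setU11 (negPf eG) expect_ignore//=; lra.
Qed.

(** Two independent copies of the random set. *)
Fixpoint expect2 s (f : {set E} -> {set E} -> R) G H : R :=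
  if s is e :: s' then
    p * (p * expect2 s' f (e |: G) (e |: H) + (1 - p) * expect2 s' f (e |: G) H)
    + (1 - p) * (p * expect2 s' f G (e |: H) + (1 - p) * expect2 s' f G H)
  else f G H.

Lemma expect2_le s (phi psi : {set E} -> {set E} -> R) G H :
  (forall G H, phi G H <= psi G H) -> expect2 s phi G H <= expect2 s psi G H.
Proof.
move=> le; elim: s G H => [|e s IH] G H //=.
by rewrite lerD// ler_wpM2l// lerD// ler_wpM2l.
Qed.

Lemma expect2_prod s f g G H :
  expect2 s (fun G H => f G * g H) G H = expect s f G * expect s g H.
Proof. by elim: s G H => [|e s IH] G H //=; rewrite !IH; ring. Qed.

(** The coordinates in [s] only average the hypothesis with nonnegative weights, so a shared
    coordinate [e] may be compared pointwise with two independent ones. *)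
Lemma expect2_split s (phi psi : {set E} -> {set E} -> R) e :
  let le_split (F1 F2 : {set E} -> {set E} -> R) := forall G H,
    p * F1 (e |: G) (e |: H) + (1 - p) * F1 G H <=
    p * (p * F2 (e |: G) (e |: H) + (1 - p) * F2 (e |: G) H)
    + (1 - p) * (p * F2 G (e |: H) + (1 - p) * F2 G H) in
  le_split phi psi -> le_split (expect2 s phi) (expect2 s psi).
Proof.
move=> le_split le; elim: s => [|a s IH] //=; rewrite /le_split in IH *.
move=> G H; rewrite !(setUCA [set a]).
have h1 := ler_wpM2l p0 (ler_wpM2l p0 (IH (a |: G) (a |: H))).
have h2 := ler_wpM2l p0 (ler_wpM2l q0 (IH (a |: G) H)).
have h3 := ler_wpM2l q0 (ler_wpM2l p0 (IH G (a |: H))).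
have h4 := ler_wpM2l q0 (ler_wpM2l q0 (IH G H)).
lra.
Qed.

Variables A B : {set E} -> bool.

(* [S] is the set of coordinates that have not been duplicated yet: only there
   do the witnesses [K] and [L] have to be disjoint. *)
Let box (S G H : {set E}) : bool :=
  [exists K : {set E}, exists L : {set E},
    [&& K \subset G, L \subset H, A K, B L & [disjoint K & S :&: L]]].

Let box_subset (S S' : {set E}) G G' H H' :
  S' \subset S -> G \subset G' -> H \subset H' ->
  box S G H -> box S' G' H'.
Proof.
move=> SS GG HH /existsP[K] /existsP[L] /and5P[KG LH AK BL KL].
apply/existsP; exists K; apply/existsP; exists L.
rewrite (subset_trans KG)// (subset_trans LH)// AK BL/=.
by apply: disjointWr KL; rewrite setSI.
Qed.

(** If [box S G H] holds, the right side is 1. Otherwise only the first term on the left can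
    survive; at most one of its witnesses contains [e], so one copy can do without [e] and the right
    side is at least [p * p + p * (1 - p) = p]. *)
Let box_split (S : {set E}) e G H : (p * (box (e |: S) (e |: G) (e |: H))%:R
  + (1 - p) * (box (e |: S) G H)%:R : R) <=
    p * (p * (box S (e |: G) (e |: H))%:R + (1 - p) * (box S (e |: G) H)%:R)
    + (1 - p) * (p * (box S G (e |: H))%:R + (1 - p) * (box S G H)%:R).
Proof.
have sG := subsetUr [set e] G; have sH := subsetUr [set e] H.
have sS := subsetUr [set e] S.
have [b|nb] := boolP (box S G H).
  rewrite !(@box_subset S S G _ H _ _ _ _ b)//.
  have: p * (box (e |: S) (e |: G) (e |: H))%:R <= p.
    by rewrite ler_piMr// lern1 leq_b1.
  have: (1 - p) * (box (e |: S) G H)%:R <= 1 - p.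
    by rewrite ler_piMr// lern1 leq_b1.
  rewrite /=; lra.
have /negPf -> : ~~ box (e |: S) G H.
  by apply: contraNN nb; exact: box_subset.
have pq := mulr_ge0 p0 q0.
have [b|_] := boolP (box (e |: S) (e |: G) (e |: H)); last first.
  rewrite !mulr0 addr0 !addr_ge0 ?mulr_ge0// ?addr_ge0 ?mulr_ge0//.
have -> : box S (e |: G) (e |: H) by exact: box_subset b.
suff /orP[->|->] : box S (e |: G) H || box S G (e |: H).
- case: (box S G _) => /=; lra.
- case: (box S _ H) => /=; lra.
move: b => /existsP[K] /existsP[L] /and5P[KG LH AK BL KL].
have sub1 (X Y : {set E}) : X \subset e |: Y -> e \notin X -> X \subset Y.
  move=> /subsetP XY eX; apply/subsetP => x xX.
  by move: (XY _ xX); rewrite !inE => /orP[/eqP xe|//]; rewrite -xe xX in eX.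
have KL' : [disjoint K & S :&: L] by apply: disjointWr KL; rewrite setSI.
have [eK|eK] := boolP (e \in K).
  apply/orP; left; apply/existsP; exists K; apply/existsP; exists L.
  rewrite KG AK BL KL' (sub1 _ _ LH)//.
  apply/negP => eL; move/pred0P: KL => /(_ e) /=.
  by rewrite !inE eK eL eqxx.
apply/orP; right; apply/existsP; exists K; apply/existsP; exists L.
by rewrite LH AK BL KL' (sub1 _ _ KG).
Qed.

(** Duplicating the coordinates one at a time can only increase the probability of [box]. At the
    start both witnesses lie in one random set; at the end they lie in independent copies and need
    not be disjoint any more. *)
Lemma van_den_berg_kesten s G :
  (forall G H, G \subset H -> A G -> A H) ->
  (forall G H, G \subset H -> B G -> B H) ->
  expect s (fun H => [exists K : {set E}, exists L : {set E},
    [&& K \subset H, L \subset H, A K, B L & [disjoint K & L]]]%:R) G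
  <= expect s (fun H => (A H)%:R) G * expect s (fun H => (B H)%:R) G.
Proof.
move=> Amono Bmono.
have step S : expect s (fun H => (box (S :|: [set x in s]) H H)%:R) G
    <= expect2 s (fun G H => (box S G H)%:R) G G.
  elim: s S G => [|e s IH] S G /=.
    by rewrite (_ : [set x in [::]] = set0) ?setU0.
  rewrite set_cons setUCA setUA.
  have IH1 := ler_wpM2l p0 (IH (e |: S) (e |: G)).
  have IH0 := ler_wpM2l q0 (IH (e |: S) G).
  apply: le_trans (lerD IH1 IH0) _.
  by apply: (expect2_split _ (e := e)) => G' H'; exact: box_split.
rewrite -expect2_prod.
apply: le_trans (le_trans (step set0) _).
  apply: expect_le => H; rewrite ler_nat; case: existsP => //= -[K].
  move=> /existsP[L] /and5P[KG LH AK BL KL].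
  rewrite (_ : box _ _ _)//; apply/existsP; exists K; apply/existsP; exists L.
  by rewrite KG LH AK BL/=; apply: disjointWr KL; exact: subsetIr.
apply: expect2_le => G' H'; rewrite -natrM mulnb ler_nat.
case: (boolP (box _ _ _)) => // /existsP[K] /existsP[L].
by move=> /and5P[KG LH AK BL _]; rewrite (Amono _ _ KG)// (Bmono _ _ LH).
Qed.
End bernoulli_product.

(** * Self-avoiding paths from a vertex and the branching recursion *)

Section reach.
Import mathcomp.boot.fintype mathcomp.boot.finset.
Context {T E : finType} (ed : T -> T -> E).
Hypothesis ed_inj : forall v w v' w', ed v w = ed v' w' -> v = v'.
Implicit Types (G H : {set E}) (U : {set T}) (v w : T).

(** [U] holds the vertices still available, which makes the path self-avoiding. The parameter [ed]
    lets paths be followed along or against the arrows. *)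
Fixpoint reach G k U v : bool :=
  if k is k'.+1 then
    [exists w, [&& w \in U, ed v w \in G & reach G k' (U :\ w) w]]
  else true.

Lemma reach_path G v (s : seq T) U : path [rel x y | ed x y \in G] v s ->
  uniq s -> {subset s <= U} -> reach G (size s) U v.
Proof.
elim: s v U => [|w s IH] //= v U /andP[vw ps] /andP[ws us] sU.
apply/existsP; exists w; rewrite vw sU ?mem_head//=.
apply: IH => // x xs; rewrite !inE sU ?inE ?xs ?orbT// andbT.
by apply: contraNneq ws => <-.
Qed.

Lemma reach_mono k U v G H : G \subset H -> reach G k U v -> reach H k U v.
Proof.
move=> GH; elim: k U v => [|k IH] //= U v /existsP[w /and3P[wU vw r]].
by apply/existsP; exists w; rewrite wU (subsetP GH _ vw) IH.
Qed.

(** The path never visits [v], and by [ed_inj] an edge determines the vertex from which it is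
    followed. *)
Lemma reach_ignore k U v w x G : v \notin U -> x != v ->
  reach (ed v w |: G) k U x = reach G k U x.
Proof.
elim: k U x => [|k IH] //= U x vU xv; apply: eq_existsb => y.
have [yU|//] := boolP (y \in U).
have -> : (ed x y \in ed v w |: G) = (ed x y \in G).
  rewrite !inE; case: eqP => // /ed_inj xv'; by rewrite xv' eqxx in xv.
rewrite IH//; first by rewrite !inE negb_and vU orbT.
by apply: contraNneq vU => <-.
Qed.

Context {R : realFieldType} (p : R) (s : seq E).
Hypothesis p01 : 0 <= p <= 1.
Hypothesis us : uniq s.

(** The failures of the possible first steps [w] are decreasing events, so by Harris they occur
    together with at least the product of their probabilities. The edge to [w] is independent of the
    continuation, which avoids [v]. *)
Lemma reach_probS k U v (a : R) : v \notin U -> 0 <= a <= 1 ->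
  (forall w, w \in U ->
    expect p s (fun G => (reach G k (U :\ w) w)%:R) set0 <= a) ->
  expect p s (fun G => (reach G k.+1 U v)%:R) set0 <= 1 - (1 - p * a) ^+ #|U|.
Proof.
move=> vU /andP[a0 a1] ra; have /andP[p0 p1] := p01.
pose F w G : R := 1 - ((ed v w \in G) && reach G k (U :\ w) w)%:R.
have F0 w G : 0 <= F w G by rewrite subr_ge0 lern1 leq_b1.
have Fa w : antitone (F w).
  move=> G H GH; rewrite lerB// ler_nat; case: andP => // -[vw r].
  by rewrite (subsetP GH _ vw) (reach_mono GH r).
have -> : expect p s (fun G => (reach G k.+1 U v)%:R) set0 =
    1 - expect p s (fun G => \prod_(w in U) F w G) set0.
  rewrite -expectB1; apply: le_anti; rewrite !expect_le// => G /=.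
    case: existsP => [_|nr]; first by rewrite gerBl prodr_ge0.
    rewrite big1 ?subrr// => w wU; rewrite /F.
    case: andP => [[vw r]|]; rewrite ?subr0//.
    by case: nr; exists w; rewrite wU vw.
  case: existsP => [[w /and3P[wU vw r]]|_].
    by rewrite (bigD1 w)//= /F vw r subrr mul0r subr0.
  by rewrite subr_ge0 prodr_ile1// => w _; rewrite F0 gerBl ler0n.
rewrite lerB//; apply: le_trans (harris_prod p01 _ _ _ Fa F0).
rewrite -prodr_const; apply: ler_prod => w wU.
rewrite subr_ge0 mulr_ile1//= expectB1 lerB//.
have wv : w != v by apply: contraNneq vU => <-.
pose f G : R := (reach G k (U :\ w) w)%:R.
apply: le_trans (_ : p * expect p s f set0 <= _); last first.
  by rewrite ler_wpM2l// ra.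
have := @expect_mem _ _ _ p01 s f (ed v w) set0 us.
rewrite inE => /(_ isT (fun H => ler0n _ _)) H.
apply: le_trans (H _); last first.
  by move=> G; rewrite /f reach_ignore// !inE negb_and vU orbT.
by apply: expect_le => // G; rewrite -natrM mulnb.
Qed.

(** A rational bound on [1 - (1 - x) ^+ n.+1] that is exact to second order in [x]. In the induction
    step, with denominators cleared, the surplus is [(n + 2) * (n + 1) * x ^+ 3]. *)
Lemma binomial_survival (n : nat) (x : R) : 0 <= x <= 1 ->
  (1 - (1 - x) ^+ n.+1) * (2 + n%:R * x) <= 2 * (n.+1%:R * x).
Proof.
move=> /andP[x0 x1]; elim: n => [|n IH]; first by rewrite expr1; lra.
have n0 : 0 <= n%:R * x by rewrite mulr_ge0.
have d0 : 0 < 2 + n%:R * x by lra.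
have x1' : 0 <= 1 - x by lra.
have d1 : 0 <= 2 + n.+1%:R * x by rewrite -natr1; lra.
rewrite -(ler_pM2r d0) exprS.
have := ler_wpM2l (mulr_ge0 x1' d1) IH.
set u := (1 - x) ^+ n.+1; rewrite -(natr1 n.+1) -(natr1 n) => IHd.
have nx : 0 <= (n%:R + 1 + 1) * (n%:R + 1) * x * x * x.
  by rewrite !mulr_ge0// !addr_ge0.
lra.
Qed.

(* With [h] the probability at step [k] and [z = n.+1 * p * h], the next one is at
   most [4 z / (4 + z)]: up to the factor [1 + eps], [1 / h] grows by [1 / 4]. *)
Lemma reach_prob (n k : nat) (eps : R) U v : (0 < n)%N -> 0 <= eps ->
  n.+1%:R * p <= 1 + eps -> v \notin U -> (#|U| <= n.+1)%N ->
  k%:R * expect p s (fun G => (reach G k U v)%:R) set0 <= 4 * (1 + eps) ^+ k.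
Proof.
move=> n0 e0 np vU Un; have /andP[p0 p1] := p01.
(* The recursion needs a bound [a] uniform in [U] and [v], since both change at each step. *)
suff [a [a01 ka ra]] : exists a : R, [/\ 0 <= a <= 1,
    k%:R * a <= 4 * (1 + eps) ^+ k &
    forall U v, v \notin U -> (#|U| <= n.+1)%N ->
    expect p s (fun G => (reach G k U v)%:R) set0 <= a].
  by apply: le_trans ka; rewrite ler_wpM2l// ra.
elim: k {U v vU Un} => [|k [a [a01 ka ra]]].
  exists 1; split; [by rewrite ler01 lexx|by rewrite mul0r expr0; lra|].
  by move=> U v _ _ /=; rewrite expect_cst.
have /andP[a0 a1] := a01.
have pa0 : 0 <= p * a by rewrite mulr_ge0.
have pa1 : p * a <= 1 by rewrite mulr_ile1.
have q0 : 0 <= 1 - p * a by lra.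
have q1 : 1 - p * a <= 1 by lra.
exists (1 - (1 - p * a) ^+ n.+1); split.
- by rewrite subr_ge0 exprn_ile1//= gerBl exprn_ge0.
- have := @binomial_survival n (p * a); rewrite pa0 pa1 => /(_ isT).
  set y := 1 - _ => yb.
  have y0 : 0 <= y by rewrite subr_ge0 exprn_ile1.
  set z := n.+1%:R * (p * a) in yb.
  have z0 : 0 <= z by rewrite mulr_ge0.
  have za : z <= (1 + eps) * a by rewrite /z mulrA ler_wpM2r.
  (* Here [0 < n] enters, as [n.+1 <= 2 * n]; it replaces [n] by [n.+1] in the denominator at the
     cost of a factor 2. *)
  have nz : z <= 2 * (n%:R * (p * a)).
    rewrite /z [leRHS]mulrA ler_wpM2r// -natrM ler_nat.
    by rewrite mul2n -addnn -addn1 leq_add2l.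
  have yz : y * (4 + z) <= 4 * z.
    by have := ler_wpM2l y0 nz; lra.
  have c1 : 1 <= (1 + eps) ^+ k.+1 by rewrite exprn_ege1// lerDl.
  have kz : k%:R * z <= 4 * (1 + eps) ^+ k.+1.
    apply: le_trans (ler_wpM2l _ za) _; rewrite ?ler0n// mulrCA exprS.
    rewrite [leRHS]mulrCA ler_wpM2l//; lra.
  have z4 : 0 < 4 + z by lra.
  (* With [c = (1 + eps) ^+ k.+1], the bounds [k * z <= 4 * c] and [1 <= c] give
     [(k + 1) * 4 * z <= 4 * c * (4 + z)]. *)
  rewrite -(ler_pM2r z4) -natr1.
  have := ler_wpM2l (ler0n R k.+1) yz; rewrite -natr1.
  have := ler_wpM2r z0 c1; lra.
- move=> U v vU Un; apply: le_trans (reach_probS vU a01 _) _ => [w wU|].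
    apply: ra; first by rewrite !inE eqxx.
    by apply: leq_trans Un; rewrite subset_leq_card// subsetDl.
  by rewrite lerB// ler_wiXn2l.
Qed.
End reach.

Local Open Scope classical_set_scope.
Local Open Scope ring_scope.

(** * Middles of long paths: counting them and bounding their expected number *)

Section bipath.
Context {T : finType}.
Implicit Types (G : {set T * T}) (v : T) (l : seq T).

(* [v] is the middle of an oriented path of length [2 * m], in the weak sense
   that the two halves may have common vertices but no common edge. *)
Definition bipath m G v : bool := [exists K : {set T * T}, exists L : {set T * T},
  [&& K \subset G, L \subset G,
      reach pair K m (finset.setC [set v]%SET) v,
      reach (fun x y => (y, x)) L m (finset.setC [set v]%SET) v
    & [disjoint K & L]]].

Lemma bipath_cat m G v a b : sorted [rel x y | (x, y) \in G] (rev a ++ v :: b) ->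
  uniq (rev a ++ v :: b) -> (m <= size a)%N -> (m <= size b)%N -> bipath m G v.
Proof.
move=> sl ul ma mb.
have /cat_sorted2[_ pb] := sl.
have pa : path [rel x y | (y, x) \in G] v a.
  by move: sl; rewrite -cat_rcons => /cat_sorted2[]; rewrite -rev_cons rev_sorted.
move: ul; rewrite cat_uniq rev_uniq /= => /and4P[ua /norP[va ab] vb ub].
rewrite mem_rev in va.
have reach_take (ed : T -> T -> T * T) (K : {set T * T}) c : (m <= size c)%N ->
    path [rel x y | ed x y \in K] v c -> uniq c -> v \notin c ->
    reach ed K m (finset.setC [set v]%SET) v.
  move=> mc pc uc vc; rewrite -[m in reach _ _ m](size_takel mc).
  apply: reach_path; [exact: take_path|exact: take_uniq|].
  by move=> x /mem_take xc; rewrite !inE; apply: contraNneq vc => <-.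
(* Edges are sorted by their origin: the outgoing half uses origins in [v :: b], the incoming half
   origins in [a], and these are disjoint. *)
apply/existsP; exists [set e in G | e.1 \in v :: b]%SET.
apply/existsP; exists [set e in G | e.1 \in a]%SET.
apply/and5P; split.
- by apply/fintype.subsetP => e; rewrite inE => /andP[].
- by apply/fintype.subsetP => e; rewrite inE => /andP[].
- apply: (reach_take _ _ b) => //.
  apply: sub_in_path (_ : all (mem (v :: b)) (v :: b)) pb; last exact/allP.
  by move=> x y xb _ /=; rewrite inE => ->.
- apply: (reach_take _ _ a) => //.
  suff: forall c w, path [rel x y | (y, x) \in G] w c -> {subset c <= a} ->
      path [rel x y | (y, x) \in [set e in G | e.1 \in a]%SET] w c by apply.
  elim=> [|y c IH] //= w /andP[yw pc] ca; rewrite inE yw ca ?mem_head//= IH//.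
  by move=> x xc; rewrite ca// inE xc orbT.
- apply/pred0P => e; apply/negP => /andP[/setIdP[_ eb] /setIdP[_ ea]].
  move: eb; rewrite inE => /orP[/eqP ev|eb].
    by rewrite -ev ea in va.
  by move/hasP: ab; apply; exists e.1; rewrite // mem_rev.
Qed.

Lemma card_bipath m D G l : sorted [rel x y | (x, y) \in G] l -> uniq l ->
  (m + D + m <= size l)%N -> (D <= #|[set v | bipath m G v]%SET|)%N.
Proof.
move=> sl ul mDm.
(* These vertices have at least [m] vertices of the path on either side. *)
pose l' := take D (drop m l).
have sl' : size l' = D.
  have h := leq_trans (leq_addr m _) mDm.
  by rewrite size_takel// size_drop leq_subRL// (leq_trans (leq_addr D m)).
rewrite -sl' -(card_uniqP _); last by rewrite take_uniq// drop_uniq.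
apply: subset_leq_card; apply/fintype.subsetP => v /(nthP v)[i].
rewrite sl' => iD <-.
rewrite inE nth_take// nth_drop.
set t := (m + i)%N; set v' := nth v l t.
have tl : (t < size l)%N.
  rewrite (leq_trans _ mDm)// -addnA /t -addnS leq_add2l.
  by rewrite (leq_trans iD)// leq_addr.
have lE : l = rev (rev (take t l)) ++ v' :: drop t.+1 l.
  by rewrite revK -drop_nth// cat_take_drop.
apply: (@bipath_cat _ _ _ (rev (take t l)) (drop t.+1 l)); rewrite -?lE//.
  by rewrite size_rev size_takel ?leq_addr// ltnW.
rewrite size_drop leq_subRL// (leq_trans _ mDm)// leq_add2r.
by rewrite /t -addnS leq_add2l.
Qed.

Context {R : realFieldType} (p : R) (s : seq (T * T)).
Hypothesis p01 : 0 <= p <= 1.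
Hypothesis us : uniq s.

Lemma expect_card_bipath (n m : nat) (eps : R) : (0 < n)%N -> (#|T| <= n)%N ->
  0 <= eps -> n.+1%:R * p <= 1 + eps ->
  m%:R ^+ 2 * expect p s (fun G => #|[set v | bipath m G v]%SET|%:R) finset.set0
  <= n%:R * (4 * (1 + eps) ^+ m) ^+ 2.
Proof.
move=> n0 Tn e0 np.
pose c := (4 * (1 + eps) ^+ m : R).
have c0 : 0 <= c by rewrite mulr_ge0 ?exprn_ge0// addr_ge0.
have one v :
    m%:R ^+ 2 * expect p s (fun G => (bipath m G v)%:R) finset.set0 <= c ^+ 2.
  pose U : {set T} := finset.setC [set v]%SET.
  have vU : v \notin U by rewrite !inE eqxx.
  have Un : (#|U| <= n.+1)%N by rewrite (leq_trans (max_card _))// (leq_trans Tn).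
  have bk := @van_den_berg_kesten _ _ _ p01 (reach pair ^~ m ^~ U ^~ v)
     (fun G => reach (fun x y => (y, x)) G m U v) s finset.set0.
  have prob (ed : T -> T -> T * T) :
      (forall x y x' y', ed x y = ed x' y' -> x = x') ->
      m%:R * expect p s (fun G => (reach ed G m U v)%:R) finset.set0 <= c.
    by move=> ed_inj; exact: (reach_prob ed_inj p01 us _ n0).
  have m2 : 0 <= m%:R ^+ 2 :> R by exact: exprn_ge0.
  apply: le_trans (ler_wpM2l m2 (bk _ _)) _.
  - by move=> G H; exact: reach_mono.
  - by move=> G H; exact: reach_mono.
  - rewrite expr2 mulrACA [leRHS]expr2.
    apply: ler_pM; [by rewrite mulr_ge0 ?expect_ge0..| |].
      by apply: prob => ? ? ? ? [].
    by apply: prob => ? ? ? ? [].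
have -> : expect p s (fun G => #|[set v | bipath m G v]%SET|%:R) finset.set0 =
    \sum_v expect p s (fun G => (bipath m G v)%:R : R) finset.set0.
  rewrite -expect_sum; congr expect; apply/funext => G.
  rewrite -sum1_card natr_sum big_mkcond/=; apply: eq_bigr => v _.
  by rewrite inE; case: bipath.
rewrite mulr_sumr; apply: le_trans (ler_sum _ (fun v _ => one v)) _.
by rewrite sumr_const -[leLHS]mulr_natl ler_wpM2r ?exprn_ge0// ler_nat.
Qed.

End bipath.

(** * From the law of the random digraph to the recursive expectation *)

Section gnp_expectation.
Context {R : realType}.

Lemma expect_subset (E : finType) (p : R) (s : seq E) (f : {set E} -> R)
    (G0 : {set E}) : uniq s ->
  \sum_(G : {set E} | G \subset [set e in s]%SET)
    \prod_(e <- s) bernoulli_pmf p (e \in G) * f (G0 :|: G)%SET = expect p s f G0.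
Proof.
elim: s G0 => [|e s IH] G0 /=.
  move=> _; rewrite (big_pred1 finset.set0) => [|G].
    by rewrite big_nil mul1r finset.setU0.
  by rewrite /= -finset.subset0; congr (_ \subset _).
move=> /andP[es us]; rewrite (bigID (fun G : {set E} => e \in G))/=.
congr (_ + _).
  rewrite -IH// mulr_sumr.
  (* Subsets of [e :: s] containing [e] correspond to subsets of [s]. *)
  rewrite (reindex_onto (fun G => e |: G)%SET (fun G => G :\ e)%SET) /=; last first.
    by move=> G /andP[_ eG]; rewrite finset.setD1K.
  apply: eq_big => [G|G /andP[/andP[_ _] /eqP eG]].
    rewrite finset.setU11 andbT set_cons; apply/idP/idP.
      by move=> /andP[Gs /eqP <-]; rewrite finset.subDset.
    move=> Gs; rewrite finset.setUS//= finset.setU1K//.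
    by apply: contra es => /(fintype.subsetP Gs); rewrite inE.
  rewrite big_cons finset.setU11 -mulrA finset.setUCA finset.setUA.
  congr (_ * (_ * _)); apply: eq_big_seq => x xs; rewrite !inE.
  by case: eqP => // xe; rewrite -xe xs in es.
rewrite -IH// mulr_sumr; apply: eq_big => [G|G /andP[_ /negPf eG]].
  by rewrite set_cons -finset.subsetD1 finset.setU1K// inE.
by rewrite big_cons eG -mulrA.
Qed.

Lemma expect_imset (E F : finType) (h : E -> F) (p : R) (s : seq E)
    (f : {set F} -> R) (G : {set E}) :
  expect p (map h s) f (h @: G)%SET = expect p s (fun H => f (h @: H)%SET) G.
Proof. by elim: s G => [|e s IH] G //=; rewrite -imsetU1 !IH. Qed.

Definition pair_edges n : seq ('I_n * 'I_n) := map val (index_enum (edge n)).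

Lemma gnp_expect n (p : R) (f : {set 'I_n * 'I_n} -> R) :
  \sum_(G : digraph n) gnp_pmf p G * f [set val e | e in (G : {set edge n})]%SET =
  expect p (pair_edges n) f finset.set0.
Proof.
rewrite /pair_edges -(imset0 (val : edge n -> _)) expect_imset.
rewrite -expect_subset ?index_enum_uniq//.
apply: eq_big => [G|G _]; last by rewrite finset.set0U.
by apply/esym/fintype.subsetP => e _; rewrite inE mem_index_enum.
Qed.

Lemma gnp_markov n (p : R) (A : set (digraph n)) (X : digraph n -> R) :
  0 <= p <= 1 -> (forall G, 0 <= X G) -> (forall G, A G -> 1 <= X G) ->
  (gnp_prob n p A <= (\sum_(G : digraph n) gnp_pmf p G * X G)%:E)%E.
Proof.
move=> p01 X0 AX; rewrite /gnp_prob p01 fsbig_mkcond.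
have -> : [set: digraph n] = [set` index_enum (digraph n)].
  by apply/esym/seteqP; split => G //= _; exact: mem_index_enum.
rewrite -fsbig_seq ?index_enum_uniq// -sumEFin; apply: lee_sum => G _.
rewrite patchE; case: ifPn => [/set_mem/AX X1|_]; rewrite lee_fin.
  by rewrite ler_peMr// gnp_pmf_ge0.
by rewrite mulr_ge0// gnp_pmf_ge0.
Qed.
End gnp_expectation.

(** The second components of the pairs form [s] itself; hence vertex-distinct paths are saops. *)
Lemma uniq_pairmap_pair (T : eqType) (x : T) s : uniq s -> uniq (pairmap pair x s).
Proof.
have {1}-> : s = unzip2 (pairmap pair x s).
  by elim: s x => [|y s IH] x //=; rewrite -IH.
exact: map_uniq.
Qed.

(** * Tail bound for the diameter, and the critical window *)

Section diameter_tail.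
Context {R : realType}.

Lemma powR_cube_root (x : R) : 0 <= x -> (x `^ (1 / 3)) ^+ 3 = x.
Proof.
by move=> x0; rewrite -powR_mulrn ?powR_ge0// -powRrM mulfVK// powRr1.
Qed.

(** A shortest saop is no longer than the vertex-distinct path extracted from it. The absolute value
    is harmless: a vertex is at distance 0 from itself. *)
Lemma diam_le n (G : digraph n) K : (0 < n)%N ->
  (forall x s, path (arrow G) x s -> uniq (x :: s) -> (size s <= K)%N) ->
  `|diam G : R| <= K%:R.
Proof.
move=> n0 sK; rewrite -lee_fin -abse_EFin diamE// gee0_abs.
  apply: bigmax_le => [|i _]; first exact: leNye.
  apply: bigmax_le => [|j _]; first exact: leNye.
  rewrite /dist; case: pselect => [ex|_]; last exact: leNye.
  rewrite lee_fin ler_nat; case: ex_minnP => k.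
  move=> /existsP[t /andP[/andP[pt _] /eqP lt]] kmin.
  move: lt; case/shortenP: pt => s ps us _ ls.
  apply: leq_trans (sK _ _ ps us); apply: kmin.
  apply/existsP; exists (in_tuple s); rewrite /saop/= ps ls eqxx andbT/=.
  by apply: uniq_pairmap_pair; case/andP: us.
pose i := Ordinal n0.
apply: le_trans (le_bigmax_cond _ _ (isT : xpredT i)).
apply: le_trans (le_bigmax_cond _ _ (isT : xpredT i)).
rewrite /dist; case: pselect => [ex|[]]; first by rewrite lee_fin ler0n.
by exists 0%N; apply/existsP; exists [tuple]; rewrite /= eqxx.
Qed.

Lemma gnp_diam_tail n (p lam : R) (A : nat) : (0 < n)%N -> (0 < A)%N ->
  0 <= p <= 1 -> 0 <= lam -> n.+1%:R * p <= 1 + lam / n%:R `^ (1 / 3) ->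
  (gnp_prob n p [set G | (A.+2%:R < `|diam G / n%:R `^ (1 / 3) : R|)%R]
   <= (128 * expR lam ^+ 2 / A%:R)%:E)%E.
Proof.
move=> n0 A0 p01 lam0 np; set r := n%:R `^ (1 / 3) in np *.
have r3 : r ^+ 3 = n%:R by exact: powR_cube_root.
have r1 : 1 <= r.
  have : 1 <= r ^+ 3 by rewrite r3 ler1n.
  by rewrite expr_ge1// powR_ge0.
have r0 : 0 < r by lra.
have /andP[mr rm] := truncn_itv (ltW r0); set m := Num.truncn r in mr rm.
clearbody m.
have m0 : (0 < m)%N by rewrite -(ltr_nat R); rewrite -natr1 in rm; lra.
have m1 : 1 <= m%:R :> R by rewrite ler1n.
have mR : 0 < m%:R :> R by lra.
have e0 : 0 <= lam / m%:R by rewrite divr_ge0.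
(* Weakening [lam / r] to [lam / m] makes the [m]-th power at most [expR lam]. *)
have npm : n.+1%:R * p <= 1 + lam / m%:R.
  by rewrite (le_trans np)// lerD2l ler_wpM2l// lef_pV2 ?posrE.
have pow_le : (1 + lam / m%:R) ^+ m <= expR lam.
  apply: le_trans (_ : expR (lam / m%:R) ^+ m <= _).
    by rewrite lerXn2r ?nnegrE ?addr_ge0 ?expR_ge0// expR_ge1Dx.
  by rewrite -expRM_natl mulrC divfK ?gt_eqF.
pose N (G : digraph n) :=
  #|[set v | bipath m [set val e | e in (G : {set edge n})]%SET v]%SET|.
have A0R : 0 < A%:R :> R by rewrite ltr0n.
have AmR : 0 < A%:R * m%:R :> R by rewrite mulr_gt0.
(* Markov's inequality is applied to [X]: a diameter above [A.+2 * r] exceeds [A.+2 * m], and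
   dropping [m] vertices at each end of a long path leaves [A * m] middles. *)
pose X G := (A%:R * m%:R)^-1 * (N G)%:R : R.
apply: le_trans (@gnp_markov _ _ _ _ X p01 _ _) _.
- by move=> G; rewrite mulr_ge0// invr_ge0 ltW.
- move=> G /= GA; rewrite /X mulrC ler_pdivlMr// mul1r -natrM ler_nat leqNgt.
  apply/negP => NA; suff dG : `|diam G : R| <= (A.+2 * m)%:R.
    move: GA; rewrite normrM normfV (gtr0_norm r0) ltr_pdivlMr// => GA.
    have := le_lt_trans (ler_wpM2l (ler0n R A.+2) mr) GA.
    by rewrite -natrM ltNge dG.
  apply: diam_le => // x s ps us; rewrite leqNgt; apply/negP => sA.
  move: NA; rewrite ltnNge => /negP; apply.
  apply: (@card_bipath _ m (A * m) _ (x :: s)) => //=.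
  rewrite ltnW// ltnS (leq_trans _ sA)//.
  by rewrite -addn2 mulnDl mul2n -addnn addnA (addnC m) ltnW.
- rewrite lee_fin; under eq_bigr do rewrite /X mulrCA.
  rewrite -mulr_sumr (gnp_expect p (fun G => #|[set v | bipath m G v]%SET|%:R)).
  have us : uniq (pair_edges n).
    by rewrite map_inj_uniq ?index_enum_uniq//; exact: val_inj.
  have := @expect_card_bipath _ _ p _ p01 us n m _ n0 _ e0 npm.
  rewrite card_ord leqnn => /(_ isT).
  set Y := expect _ _ _ _ => HY.
  (* Since [r < m + 1 <= 2 * m]. This 8 and the square of the 4 in [reach_prob] make up the constant
     128. *)
  have n8 : n%:R <= 8 * m%:R ^+ 3 :> R.
    rewrite -r3; apply: le_trans (_ : (2 * m%:R) ^+ 3 <= _).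
      have rm2 : r <= 2 * m%:R by rewrite -natr1 in rm; lra.
      by rewrite lerXn2r// nnegrE ?mulr_ge0// ltW.
    by rewrite exprMn ler_wpM2r ?exprn_ge0// -natrX ler_nat.
  rewrite mulrC ler_pdivrMr// mulrA divfK ?gt_eqF//.
  have m2 : 0 < m%:R ^+ 2 :> R by rewrite exprn_gt0.
  rewrite -(ler_pM2l m2); apply: le_trans HY _.
  have c2 : (4 * (1 + lam / m%:R) ^+ m) ^+ 2 <= (4 * expR lam) ^+ 2.
    rewrite lerXn2r ?nnegrE ?mulr_ge0 ?expR_ge0 ?exprn_ge0 ?addr_ge0//.
    by rewrite ler_wpM2l.
  apply: le_trans (_ : 8 * m%:R ^+ 3 * (4 * expR lam) ^+ 2 <= _).
    by rewrite ler_pM// exprn_ge0// mulr_ge0// exprn_ge0// addr_ge0.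
  by rewrite le_eqVlt; apply/orP; left; apply/eqP; ring.
Qed.

Lemma critical_window (p : nat -> R) : (forall n, (0 < n)%N -> 0 <= p n <= 1) ->
  p = (fun n => 1 / n%:R) +O_\oo (fun n => n%:R `^ (- (4 / 3))) ->
  exists2 lam : R, 0 <= lam & forall n, (0 < n)%N ->
    n.+1%:R * p n <= 1 + lam / n%:R `^ (1 / 3).
Proof.
move=> p01 /eqaddOP /pinfty_ex_gt0[C C0 [N _ HN]].
(* For [N <= n], [n * p n * r <= r + C] and [p n * r <= C + 1] give [1 + 2 * C]. For [n < N],
   [p n <= 1] and [r <= n] give the square. *)
exists (1 + 2 * C + N.+1%:R ^+ 2).
  by rewrite !addr_ge0// ?mulr_ge0 ?exprn_ge0// ltW.
move=> n n0; set r := n%:R `^ (1 / 3).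
have r3 : r ^+ 3 = n%:R by exact: powR_cube_root.
have n1 : 1 <= n%:R :> R by rewrite ler1n.
have r1 : 1 <= r.
  have : 1 <= r ^+ 3 by rewrite r3.
  by rewrite expr_ge1// powR_ge0.
have r0 : 0 < r by lra.
have rn : r <= n%:R by rewrite -r3 -[leLHS]expr1 ler_weXn2l.
have /andP[p0 p1] := p01 _ n0.
rewrite -(ler_pM2r r0) mulrDl divfK ?gt_eqF// mul1r.
have [Nn|nN] := leqP N n.
  have := HN _ Nn; rewrite /= !fctE.
  have -> : n%:R `^ (- (4 / 3)) = (n%:R * r)^-1.
    rewrite powRN; congr (_^-1).
    have -> : 4 / 3 = 1 + 1 / 3 :> R by field.
    by rewrite powRD ?powRr1//; apply/implyP => _; rewrite gt_eqF//; lra.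
  rewrite [`|_^-1|]ger0_norm; last by rewrite invr_ge0 mulr_ge0// ltW.
  move=> /(le_trans (ler_norm _)); rewrite lerBlDr => pn.
  have nr : 0 < n%:R * r by rewrite mulr_gt0//; lra.
  have pnr : p n * (n%:R * r) <= C + r.
    have := ler_wpM2r (ltW nr) pn; rewrite mulrDl divfK ?gt_eqF//.
    by rewrite mul1r mulKf// gt_eqF//; lra.
  have pr : p n * r <= C + 1.
    have n0' : 0 < n%:R :> R by lra.
    rewrite -(ler_pM2r n0').
    have : C <= C * n%:R by rewrite ler_peMr// ltW.
    lra.
  have : 0 <= N.+1%:R ^+ 2 :> R by rewrite exprn_ge0.
  rewrite -natr1; lra.
have Nr : n.+1%:R * r <= N.+1%:R ^+ 2.
  rewrite expr2 ler_pM// ?(ltW r0)// ?ler_nat; first exact: ltnW.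
  by rewrite (le_trans rn)// ler_nat ltnW// ltnW.
have : n.+1%:R * p n * r <= n.+1%:R * r.
  by rewrite ler_wpM2r ?(ltW r0)// ler_piMr.
lra.
Qed.
End diameter_tail.

Theorem theorem1 (R : realType) (p : nat -> R)
    (p01 : forall n, (0 < n)%N -> 0 <= p n <= 1)
    (pE : p = (fun n => 1 / n%:R) +O_\oo (fun n => n%:R `^ (- (4 / 3)))) :
  stochastic_bigO (fun n => gnp_prob n (p n))
    (fun n => diam) (fun n => n%:R `^ (1 / 3)).
Proof.
have [lam lam0 np] := critical_window p01 pE.
move=> eps eps0; pose c : R := 128 * expR lam ^+ 2.
have c0 : 0 <= c by rewrite mulr_ge0// exprn_ge0// expR_ge0.
(* Chosen so that [c / A < eps]. *)
pose A := (Num.truncn (c / eps)).+1.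
exists A.+2%:R => n n0.
apply: le_trans (gnp_diam_tail n0 (isT : (0 < A)%N) (p01 _ n0) lam0 (np _ n0)) _.
rewrite lee_fin ler_pdivrMr ?ltr0n// -/c -ler_pdivrMl// mulrC ltW//.
by have /andP[] := truncn_itv (divr_ge0 c0 (ltW eps0)).
Qed.
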